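(* Let $a$ be the scale factor of an expanding two-dimensional Robertson-Walker spacetime with metric $ds^2=-dt^2+a^2(t)\,d\chi^2$, let $\beta(\tau)=(\tau,0)$ be the central observer, and let $(\tau,\rho)$ be Fermi coordinates with respect to $\beta$, in which $ds^2=g_{\tau\tau}(\tau,\rho)\,d\tau^2+d\rho^2$. Then the Fermi relative velocity (with respect to $\beta$) of any radially moving test particle at a point with Fermi coordinates $(\tau,\rho)$ satisfies $$\|v_{\mathrm{Fermi}}\|<\sqrt{-g_{\tau\tau}(\tau,\rho)} .$$ Consequently, at a point $(\tau,\rho)$ of a Fermi coordinate chart, the Fermi relative speed can exceed the central observer's local speed of light (that is, there is a radially moving test particle through that point with $\|v_{\mathrm{Fermi}}\|>1$) if and only if $-g_{\tau\tau}(\tau,\rho)>1$.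
   Context: Units are such that $c=1$. For radial motion it suffices to work in the two-dimensional spacetime with coordinates $(t,\chi)$, $t>0$, and metric $ds^2=-dt^2+a^2(t)\,d\chi^2$. ''Expanding'' means that the scale factor $a$ is a positive, increasing, smooth function of $t>0$. The central observer is $\beta(\tau)=(\tau,0)$, parameterized by its proper time $\tau$, with 4-velocity $\partial/\partial t$. A radially moving test particle is a future-directed timelike curve $\beta'$ in this spacetime parameterized by proper time, located at $\chi>0$. Fermi coordinates $(\tau,\rho)$ with respect to $\beta$: the point with Fermi coordinates $(\tau,\rho)$ is the point reached from $p=(\tau,0)$ by travelling proper distance $\rho$ along the spacelike unit-speed geodesic that starts at $p$ orthogonally to $\beta$, in the direction of $\mathcal S_p:=\frac{1}{a(\tau)}\frac{\partial}{\partial\chi}\big|_p$. A Fermi coordinate chart is a region containing the path of $\beta$ on which $(\tau,\rho)$ are coordinates; there the metric has the form $ds^2=g_{\tau\tau}(\tau,\rho)\,d\tau^2+d\rho^2$ with $g_{\tau\tau}<0$. If the test particle has 4-velocity $\dot\tau\,\partial/\partial\tau+\dot\rho\,\partial/\partial\rho$ at the point with Fermi coordinates $(\tau,\rho)$ (overdot: derivative with respect to the particle's proper time), its Fermi relative velocity with respect to $\beta$ at $p=(\tau,0)$ is the vector $v_{\mathrm{Fermi}}=\frac{d\rho}{d\tau}\mathcal S_p=\frac{\dot\rho}{\dot\tau}\mathcal S_p$, where $\mathcal S_p$ is a unit vector; so $\|v_{\mathrm{Fermi}}\|=|\dot\rho/\dot\tau|$. *)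

(* Defs.v *)
From Stdlib Require Import Reals.
From Coquelicot Require Import Coquelicot.
Open Scope R_scope.

(* All derivatives below are Coquelicot's total [Derive]; they are taken only
   on open sets on which the functions are assumed smooth. *)

Definition smooth_on (I : R -> Prop) (f : R -> R) : Prop :=
  forall (n : nat) (s : R), I s -> ex_derive_n f n s.

Definition smooth2_on (D : R * R -> Prop) (f : R -> R -> R) : Prop :=
  forall (n : nat) (x y : R), D (x, y) -> ex_diff_n f n x y.

Definition open_interval (I : R -> Prop) : Prop :=
  open I /\ forall x y z : R, I x -> I z -> x <= y <= z -> I y.

Record expanding (a : R -> R) : Prop := {
  exp_pos : forall t, 0 < t -> 0 < a t;
  exp_incr : forall s t, 0 < s -> s < t -> a s < a t;
  exp_smooth : smooth_on (fun t => 0 < t) a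
}.

(* The metric -dt^2 + a(t)^2 dchi^2 at a point with time coordinate [t];
   a tangent vector (v1, v2) stands for v1 d/dt + v2 d/dchi. *)
Definition metric (a : R -> R) (t : R) (v w : R * R) : R :=
  - (fst v * fst w) + (a t) ^ 2 * (snd v * snd w).

Definition spacelike_norm (a : R -> R) (t : R) (v : R * R) : R :=
  sqrt (metric a t v v).

(* The unit vector S_p at p = (tau, 0). *)
Definition radial_unit (a : R -> R) (tau : R) : R * R := (0, / a tau).

(* Affinely parameterized geodesic: the nonzero Christoffel symbols are
   Gamma^t_{chi chi} = a a' and
   Gamma^chi_{t chi} = Gamma^chi_{chi t} = a'/a. *)
Definition geodesic (a : R -> R) (I : R -> Prop) (gt gchi : R -> R) : Prop :=
  smooth_on I gt /\ smooth_on I gchi /\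
  forall s, I s ->
    0 < gt s /\
    Derive_n gt 2 s + a (gt s) * Derive a (gt s) * (Derive gchi s) ^ 2 = 0 /\
    Derive_n gchi 2 s
      + 2 * (Derive a (gt s) / a (gt s)) * Derive gt s * Derive gchi s = 0.

(* The map (tau, rho) |-> (t, chi) following for the distance rho the geodesic
   that leaves (tau, 0) with velocity S_p (for rho < 0: the distance -rho in
   the direction -S_p).  S_p is a unit vector, so rho is proper distance.  The
   domain is an open set that contains, with each (tau, rho), the whole
   segment from (tau, 0); the largest such domain always exists and the map is
   smooth on it, by the theory of ordinary differential equations. *)
Record fermi_map (a : R -> R) := {
  fm_dom : R * R -> Prop;
  fm_t : R -> R -> R;
  fm_chi : R -> R -> R;
  fm_dom_open : open fm_dom;
  fm_dom_axis : forall tau, fm_dom (tau, 0) <-> 0 < tau;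
  fm_dom_radial : forall tau rho s, fm_dom (tau, rho) ->
    Rmin 0 rho <= s <= Rmax 0 rho -> fm_dom (tau, s);
  fm_smooth_t : smooth2_on fm_dom fm_t;
  fm_smooth_chi : smooth2_on fm_dom fm_chi;
  fm_start : forall tau, 0 < tau -> fm_t tau 0 = tau /\ fm_chi tau 0 = 0;
  fm_velocity : forall tau, 0 < tau ->
    (Derive (fm_t tau) 0, Derive (fm_chi tau) 0) = radial_unit a tau;
  fm_geodesic : forall tau, 0 < tau ->
    geodesic a (fun s => fm_dom (tau, s)) (fm_t tau) (fm_chi tau)
}.
Arguments fm_dom {a} _ _.
Arguments fm_t {a} _ _ _.
Arguments fm_chi {a} _ _ _.

(* A Fermi coordinate chart: an open region of spacetime containing the path
   of beta, mapped diffeomorphically by the coordinate functions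
   (t, chi) |-> (tau, rho), inverse to the Fermi map, onto an open set. *)
Record fermi_chart (a : R -> R) := {
  fc_map :> fermi_map a;
  fc_region : R * R -> Prop;
  fc_coords : R * R -> Prop;
  fc_tau : R -> R -> R;
  fc_rho : R -> R -> R;
  fc_region_open : open fc_region;
  fc_coords_open : open fc_coords;
  fc_region_pos : forall t chi, fc_region (t, chi) -> 0 < t;
  fc_region_beta : forall tau, 0 < tau -> fc_region (tau, 0);
  fc_coords_dom : forall p, fc_coords p -> fm_dom fc_map p;
  fc_smooth_tau : smooth2_on fc_region fc_tau;
  fc_smooth_rho : smooth2_on fc_region fc_rho;
  fc_to : forall t chi, fc_region (t, chi) ->
    fc_coords (fc_tau t chi, fc_rho t chi) /\
    fm_t fc_map (fc_tau t chi) (fc_rho t chi) = t /\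
    fm_chi fc_map (fc_tau t chi) (fc_rho t chi) = chi;
  fc_from : forall tau rho, fc_coords (tau, rho) ->
    fc_region (fm_t fc_map tau rho, fm_chi fc_map tau rho) /\
    fc_tau (fm_t fc_map tau rho) (fm_chi fc_map tau rho) = tau /\
    fc_rho (fm_t fc_map tau rho) (fm_chi fc_map tau rho) = rho
}.
Arguments fc_map {a} _.
Arguments fc_region {a} _ _.
Arguments fc_coords {a} _ _.
Arguments fc_tau {a} _ _ _.
Arguments fc_rho {a} _ _ _.

(* The coordinate vector field d/dtau, and the metric component
   g_{tau tau} = g(d/dtau, d/dtau). *)
Definition d_tau {a : R -> R} (C : fermi_chart a) (tau rho : R) : R * R :=
  (Derive (fun u => fm_t C u rho) tau, Derive (fun u => fm_chi C u rho) tau).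

Definition g_tautau {a : R -> R} (C : fermi_chart a) (tau rho : R) : R :=
  metric a (fm_t C tau rho) (d_tau C tau rho) (d_tau C tau rho).

Record test_particle (a : R -> R) := {
  tp_dom : R -> Prop;
  tp_t : R -> R;
  tp_chi : R -> R;
  tp_dom_interval : open_interval tp_dom;
  tp_smooth_t : smooth_on tp_dom tp_t;
  tp_smooth_chi : smooth_on tp_dom tp_chi;
  tp_t_pos : forall s, tp_dom s -> 0 < tp_t s;
  tp_chi_pos : forall s, tp_dom s -> 0 < tp_chi s;
  tp_future : forall s, tp_dom s -> 0 < Derive tp_t s;
  tp_proper_time : forall s, tp_dom s ->
    metric a (tp_t s) (Derive tp_t s, Derive tp_chi s)
                      (Derive tp_t s, Derive tp_chi s) = -1
}.
Arguments tp_dom {a} _ _.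
Arguments tp_t {a} _ _.
Arguments tp_chi {a} _ _.

Definition passes_through {a : R -> R} (C : fermi_chart a)
    (P : test_particle a) (s tau rho : R) : Prop :=
  tp_dom P s /\ tp_t P s = fm_t C tau rho /\ tp_chi P s = fm_chi C tau rho.

(* Components of the particle's 4-velocity in the Fermi coordinates. *)
Definition tau_dot {a : R -> R} (C : fermi_chart a) (P : test_particle a)
    (s : R) : R :=
  Derive (fun r => fc_tau C (tp_t P r) (tp_chi P r)) s.

Definition rho_dot {a : R -> R} (C : fermi_chart a) (P : test_particle a)
    (s : R) : R :=
  Derive (fun r => fc_rho C (tp_t P r) (tp_chi P r)) s.

(* The vector (rho_dot / tau_dot) S_p at p = (tau, 0), where tau is the Fermi
   time coordinate of the particle. *)
Definition v_fermi {a : R -> R} (C : fermi_chart a) (P : test_particle a)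
    (s : R) : R * R :=
  let k := rho_dot C P s / tau_dot C P s in
  let S := radial_unit a (fc_tau C (tp_t P s) (tp_chi P s)) in
  (k * fst S, k * snd S).

Definition fermi_speed {a : R -> R} (C : fermi_chart a) (P : test_particle a)
    (s : R) : R :=
  spacelike_norm a (fc_tau C (tp_t P s) (tp_chi P s)) (v_fermi C P s).

(* Main.v *)
Require Import Defs.
From Stdlib Require Import Reals Lra Lia.
From Coquelicot Require Import Coquelicot.
Open Scope R_scope.

(** The Gauss lemma puts the metric in the form [g_tautau dtau^2 + drho^2], so
    a unit timelike 4-velocity satisfies
    [g_tautau tau_dot^2 + rho_dot^2 = -1]; hence [tau_dot <> 0] and
    [(rho_dot / tau_dot)^2 = - g_tautau - 1 / tau_dot^2 < - g_tautau].
    Conversely any solution [(x, y)] of [g_tautau x^2 + y^2 = -1] is, up to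
    sign, the 4-velocity of a particle through the point, and for
    [- g_tautau > 1] there is one with [|y / x| > 1].  The point has
    [chi > 0] because [a(t)^2 dchi/drho = a(tau)] along the geodesic and
    because [g_tautau = -1] on the axis [rho = 0]. *)

(** * Calculus preliminaries: chain rule and mixed partials in two variables *)

Lemma open_slice_l (D : R * R -> Prop) (x y : R) :
  open D -> D (x, y) -> locally x (fun u => D (u, y)).
Proof.
intros oD Dxy. destruct (oD _ Dxy) as [e He]. exists e; intros z Hz.
apply He; split; simpl; trivial; apply ball_center.
Qed.

(** Differentiability needs the first partial derivative near the point, its continuity at the
    point, and the second partial derivative at the point alone. On an open [D], [ex_diff_n] at
    order 1 supplies all three. *)
Lemma differentiable_of_smooth2 (D : R * R -> Prop) (f : R -> R -> R) (x y : R) :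
  open D -> smooth2_on D f -> D (x, y) ->
  differentiable_pt_lim f x y (Derive (fun u => f u y) x) (Derive (f x) y).
Proof.
intros oD sf Dxy. apply filterdiff_differentiable_pt_lim.
apply (is_derive_filterdiff f x y (fun u v => Derive (fun z => f z v) u)).
- refine (filter_imp _ _ _ (oD _ Dxy)). intros [u v] Duv; simpl.
  apply Derive_correct. apply (sf 1%nat u v Duv).
- apply Derive_correct. apply (sf 1%nat x y Dxy).
- destruct (sf 1%nat x y Dxy) as (_ & _ & _ & [H _] & _).
  apply continuity_2d_pt_filterlim in H. exact H.
Qed.

Lemma is_derive_comp2 (D : R * R -> Prop) (f : R -> R -> R) (p q : R -> R) (s : R) :
  open D -> smooth2_on D f -> D (p s, q s) -> ex_derive p s -> ex_derive q s ->
  is_derive (fun r => f (p r) (q r)) s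
    (Derive (fun u => f u (q s)) (p s) * Derive p s + Derive (f (p s)) (q s) * Derive q s).
Proof.
intros oD sf Ds dp dq. apply is_derive_Reals, derivable_pt_lim_comp_2d.
- now apply (differentiable_of_smooth2 D).
- now apply is_derive_Reals, Derive_correct.
- now apply is_derive_Reals, Derive_correct.
Qed.

Lemma mixed_partials_comm (D : R * R -> Prop) (f : R -> R -> R) (x y : R) :
  open D -> smooth2_on D f -> D (x, y) ->
  Derive (fun v => Derive (fun u => f u v) x) y = Derive (fun u => Derive (f u) y) x.
Proof.
intros oD sf Dxy. symmetry. apply (Schwarz f x y).
- apply locally_2d_locally. refine (filter_imp _ _ _ (oD _ Dxy)).
  intros [u v] Duv; simpl.
  destruct (sf 2%nat u v Duv) as (_ & H1 & H2 & (_ & _ & H3 & _) & (_ & H4 & _)).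
  repeat split; trivial.
- destruct (sf 2%nat x y Dxy) as (_ & H1 & H2 & (_ & _ & H3 & _) & (_ & H4 & _ & [H5 _] & _)).
  exact H5.
- destruct (sf 2%nat x y Dxy) as (_ & H1 & H2 & (_ & _ & H3 & _ & [H5 _]) & _).
  exact H5.
Qed.

Lemma eq_of_derive_zero (f : R -> R) (u v : R) :
  (forall t, Rmin u v <= t <= Rmax u v -> is_derive f t 0) -> f v = f u.
Proof.
intros H. destruct (MVT_gen f u v (fun _ => 0)) as (c & _ & E).
- intros t Ht. apply H. lra.
- intros t Ht. apply continuity_pt_filterlim.
  apply (ex_derive_continuous f t). eexists. now apply H.
- lra.
Qed.

(** * Derivatives of the metric along curves and geodesics *)

Lemma metric_square_is_derive (a T V W : R -> R) (u : R) :
  ex_derive a (T u) -> ex_derive T u -> ex_derive V u -> ex_derive W u ->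
  is_derive (fun r => metric a (T r) (V r, W r) (V r, W r)) u
    (2 * (- V u * Derive V u + a (T u) * Derive a (T u) * Derive T u * (W u) ^ 2
          + (a (T u)) ^ 2 * W u * Derive W u)).
Proof.
intros da dT dV dW. unfold metric; simpl fst; simpl snd.
auto_derive. { repeat split; trivial. }
change (Derive (fun x => a x) (T u)) with (Derive a (T u)).
change (Derive (fun x => T x) u) with (Derive T u).
change (Derive (fun x => V x) u) with (Derive V u).
change (Derive (fun x => W x) u) with (Derive W u). ring.
Qed.

(** The derivative is the metric pairing of the velocity with the covariant derivative of the field
    [(V, W)] along the geodesic [(T, X)]; the other term of the product rule vanishes by the
    geodesic equations. The field will be d/dchi, the velocity itself, and d/dtau. *)
Lemma geodesic_pairing_is_derive (a T X V W : R -> R) (s : R) :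
  0 < a (T s) -> ex_derive a (T s) -> ex_derive T s -> 
  ex_derive (Derive T) s -> ex_derive (Derive X) s ->
  ex_derive V s -> ex_derive W s ->
  Derive_n T 2 s + a (T s) * Derive a (T s) * (Derive X s) ^ 2 = 0 ->
  Derive_n X 2 s
      + 2 * (Derive a (T s) / a (T s)) * Derive T s * Derive X s = 0 ->
  is_derive (fun r => metric a (T r) (V r, W r) (Derive T r, Derive X r)) s
    (- Derive T s * Derive V s + a (T s) * Derive a (T s) * V s * (Derive X s) ^ 2
     + (a (T s)) ^ 2 * Derive X s * Derive W s).
Proof.
intros pa da dT dT2 dX2 dV dW ET EX. unfold metric; simpl fst; simpl snd. 
auto_derive. { repeat split; trivial. }
change (Derive_n X 2 s) with (Derive (Derive X) s) in EX.
change (Derive_n T 2 s) with (Derive (Derive T) s) in ET.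
change (Derive (fun x => Derive X x) s) with (Derive (Derive X) s).
change (Derive (fun x => Derive T x) s) with (Derive (Derive T) s).
replace (Derive (Derive X) s) with (- (2 * (Derive a (T s) / a (T s)) * Derive T s * Derive X s)) by lra.
replace (Derive (Derive T) s) with (- (a (T s) * Derive a (T s) * (Derive X s) ^ 2)) by lra.
change (Derive (fun x => a x) (T s)) with (Derive a (T s)).
change (Derive (fun x => T x) s) with (Derive T s).
change (Derive (fun x => V x) s) with (Derive V s).
change (Derive (fun x => W x) s) with (Derive W s). field. lra.
Qed.

(** * The Fermi map: conserved quantities and the Gauss lemma *)

Lemma fermi_dom_tau_pos (a : R -> R) (F : fermi_map a) (tau rho : R) :
  fm_dom F (tau, rho) -> 0 < tau.
Proof.
intros D. apply (fm_dom_axis a F), (fm_dom_radial a F _ _ _ D).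
split; [apply Rmin_l | apply Rmax_l].
Qed.

Lemma fermi_geodesic_at (a : R -> R) (ha : expanding a) (F : fermi_map a) (tau s : R) :
  fm_dom F (tau, s) ->
  let T := fm_t F tau in let X := fm_chi F tau in
  0 < a (T s) /\ ex_derive a (T s) /\
  ex_derive T s /\ ex_derive X s /\ ex_derive (Derive T) s /\ ex_derive (Derive X) s /\
  Derive_n T 2 s + a (T s) * Derive a (T s) * (Derive X s) ^ 2 = 0 /\
  Derive_n X 2 s
      + 2 * (Derive a (T s) / a (T s)) * Derive T s * Derive X s = 0.
Proof.
intros D T X.
destruct (fm_geodesic a F tau (fermi_dom_tau_pos a F tau s D)) as (sT & sX & G).
destruct (G s D) as (pT & ET & EX).
repeat split; trivial.
- now apply (Defs.exp_pos a ha).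
- exact (exp_smooth a ha 1%nat _ pT).
- exact (sT 1%nat s D).
- exact (sX 1%nat s D).
- exact (sT 2%nat s D).
- exact (sX 2%nat s D).
Qed.

Lemma fermi_initial (a : R -> R) (F : fermi_map a) (tau : R) : 0 < tau ->
  fm_t F tau 0 = tau /\ fm_chi F tau 0 = 0 /\
  Derive (fm_t F tau) 0 = 0 /\ Derive (fm_chi F tau) 0 = / a tau.
Proof.
intros pt. destruct (fm_start a F tau pt) as [E1 E2].
pose proof (fm_velocity a F tau pt) as E. unfold radial_unit in E.
injection E as E3 E4. now repeat split.
Qed.

(* The conserved pairing of the geodesic velocity with the Killing field d/dchi. *)
Lemma fermi_angular_momentum (a : R -> R) (ha : expanding a) (F : fermi_map a) (tau rho : R) :
  fm_dom F (tau, rho) ->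
  (a (fm_t F tau rho)) ^ 2 * Derive (fm_chi F tau) rho = a tau.
Proof.
intros D. pose proof (fermi_dom_tau_pos a F tau rho D) as pt.
destruct (fermi_initial a F tau pt) as (E1 & _ & _ & E4).
rewrite (eq_of_derive_zero (fun r => (a (fm_t F tau r)) ^ 2 * Derive (fm_chi F tau) r) 0 rho).
- rewrite E1, E4. pose proof (Defs.exp_pos a ha tau pt). field; lra.
- intros s Hs. pose proof (fm_dom_radial a F tau rho s D Hs) as Ds.
  destruct (fermi_geodesic_at a ha F tau s Ds) as (H1 & H2 & H3 & H4 & H5 & H6 & H7 & H8).
  evar_last.
  (* The quantity is the pairing with d/dchi, whose components (0, 1) are constant. *)
  + apply (is_derive_ext (fun r => metric a (fm_t F tau r) (0, 1)
      (Derive (fm_t F tau) r, Derive (fm_chi F tau) r))).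
    * intros r. unfold metric; simpl fst; simpl snd.
      refine (_ : @eq R _ _). ring.
    * apply (geodesic_pairing_is_derive a (fm_t F tau) (fm_chi F tau) (fun _ => 0) (fun _ => 1));
      trivial; apply ex_derive_const.
  + rewrite !Derive_const. ring.
Qed.

(** The squared length of the velocity is constant along a geodesic, and at [rho = 0] it is g(S_p,
    S_p) = 1. *)
Lemma fermi_unit_speed (a : R -> R) (ha : expanding a) (F : fermi_map a) (tau rho : R) :
  fm_dom F (tau, rho) ->
  let d_rho := (Derive (fm_t F tau) rho, Derive (fm_chi F tau) rho) in
  metric a (fm_t F tau rho) d_rho d_rho = 1.
Proof.
intros D; simpl. pose proof (fermi_dom_tau_pos a F tau rho D) as pt.
destruct (fermi_initial a F tau pt) as (E1 & _ & E3 & E4).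
rewrite (eq_of_derive_zero (fun r => metric a (fm_t F tau r)
  (Derive (fm_t F tau) r, Derive (fm_chi F tau) r)
  (Derive (fm_t F tau) r, Derive (fm_chi F tau) r)) 0 rho).
- rewrite E1, E3, E4. pose proof (Defs.exp_pos a ha tau pt). unfold metric; simpl. field. lra.
- intros s Hs. pose proof (fm_dom_radial a F tau rho s D Hs) as Ds.
  destruct (fermi_geodesic_at a ha F tau s Ds) as (H1 & H2 & H3 & H4 & H5 & H6 & H7 & H8).
  evar_last.
  + now apply (geodesic_pairing_is_derive a (fm_t F tau) (fm_chi F tau)
      (Derive (fm_t F tau)) (Derive (fm_chi F tau))).
  + change (Derive_n (fm_t F tau) 2 s) with (Derive (Derive (fm_t F tau)) s) in H7.
    change (Derive_n (fm_chi F tau) 2 s) with (Derive (Derive (fm_chi F tau)) s) in H8.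
    (* After substituting the geodesic equations, the three terms are 1, 1 and -2 times a a' t'
       chi'^2, the last three factors taken along the geodesic. *)
    replace (Derive (Derive (fm_t F tau)) s) with
      (- (a (fm_t F tau s) * Derive a (fm_t F tau s) * Derive (fm_chi F tau) s ^ 2)) by lra.
    replace (Derive (Derive (fm_chi F tau)) s) with
      (- (2 * (Derive a (fm_t F tau s) / a (fm_t F tau s)) * Derive (fm_t F tau) s
          * Derive (fm_chi F tau) s)) by lra.
    field. lra.
Qed.

(* Differentiating [g(d_rho, d_rho) = 1] in [tau]. *)
Lemma fermi_unit_speed_derive (a : R -> R) (ha : expanding a) (F : fermi_map a) (tau s : R) :
  fm_dom F (tau, s) ->
  - Derive (fm_t F tau) s * Derive (fun u => Derive (fm_t F u) s) tau
  + a (fm_t F tau s) * Derive a (fm_t F tau s) * Derive (fun u => fm_t F u s) tau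
      * (Derive (fm_chi F tau) s) ^ 2
  + (a (fm_t F tau s)) ^ 2 * Derive (fm_chi F tau) s
      * Derive (fun u => Derive (fm_chi F u) s) tau = 0.
Proof.
intros D.
destruct (fermi_geodesic_at a ha F tau s D) as (_ & da & _).
destruct (fm_smooth_t a F 2%nat tau s D) as (_ & dT & _ & _ & (_ & dTr & _)).
destruct (fm_smooth_chi a F 2%nat tau s D) as (_ & _ & _ & _ & (_ & dXr & _)).
set (g := fun u => metric a (fm_t F u s)
  (Derive (fm_t F u) s, Derive (fm_chi F u) s)
  (Derive (fm_t F u) s, Derive (fm_chi F u) s)).
assert (E : Derive g tau = 0).
(* The domain is open, so unit speed holds at fixed [s] for all parameters near [tau]. *)
{ rewrite (Derive_ext_loc g (fun _ => 1)).
  - apply Derive_const.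
  - refine (filter_imp _ _ _ (open_slice_l _ _ _ (fm_dom_open a F) D)).
    intros u Du. now apply fermi_unit_speed. }
assert (E' : is_derive g tau (2 * (- Derive (fm_t F tau) s * Derive (fun u => Derive (fm_t F u) s) tau
  + a (fm_t F tau s) * Derive a (fm_t F tau s) * Derive (fun u => fm_t F u s) tau
      * (Derive (fm_chi F tau) s) ^ 2
  + (a (fm_t F tau s)) ^ 2 * Derive (fm_chi F tau) s
      * Derive (fun u => Derive (fm_chi F u) s) tau))).
{ unfold g. now apply (metric_square_is_derive a (fun u => fm_t F u s)
    (fun u => Derive (fm_t F u) s) (fun u => Derive (fm_chi F u) s)). }
apply is_derive_unique in E'. lra.
Qed.

(** On the axis d/dtau is the observer's 4-velocity d/dt. This gives the initial value in the Gauss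
    lemma and [g_tautau = -1] at [rho = 0]. *)
Lemma fermi_d_tau_axis (a : R -> R) (F : fermi_map a) (tau : R) : 0 < tau ->
  Derive (fun u => fm_t F u 0) tau = 1 /\ Derive (fun u => fm_chi F u 0) tau = 0.
Proof.
intros pt.
assert (L : locally tau (fun u => 0 < u)).
{ apply open_gt. exact pt. }
split.
- rewrite (Derive_ext_loc _ (fun u => u)).
  + apply Derive_id.
  + refine (filter_imp _ _ _ L). intros u pu. apply (fermi_initial a F u pu).
- rewrite (Derive_ext_loc _ (fun _ => 0)).
  + apply Derive_const.
  + refine (filter_imp _ _ _ L). intros u pu. apply (fermi_initial a F u pu).
Qed.

(* d/drho g(d_tau, d_rho) = 1/2 d/dtau g(d_rho, d_rho) = 0. *)
Lemma gauss_lemma (a : R -> R) (ha : expanding a) (F : fermi_map a) (tau rho : R) :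
  fm_dom F (tau, rho) ->
  metric a (fm_t F tau rho)
    (Derive (fun u => fm_t F u rho) tau, Derive (fun u => fm_chi F u rho) tau)
    (Derive (fm_t F tau) rho, Derive (fm_chi F tau) rho) = 0.
Proof.
intros D. pose proof (fermi_dom_tau_pos a F tau rho D) as pt.
destruct (fermi_initial a F tau pt) as (E1 & _ & E3 & E4).
destruct (fermi_d_tau_axis a F tau pt) as (E5 & E6).
rewrite (eq_of_derive_zero (fun r => metric a (fm_t F tau r)
  (Derive (fun u => fm_t F u r) tau, Derive (fun u => fm_chi F u r) tau)
  (Derive (fm_t F tau) r, Derive (fm_chi F tau) r)) 0 rho).
- rewrite E1, E3, E4, E5, E6. unfold metric; simpl. ring.
- intros s Hs. pose proof (fm_dom_radial a F tau rho s D Hs) as Ds.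
  destruct (fermi_geodesic_at a ha F tau s Ds) as (H1 & H2 & H3 & H4 & H5 & H6 & H7 & H8).
  destruct (fm_smooth_t a F 2%nat tau s Ds) as (_ & _ & _ & (_ & _ & dV & _) & _).
  destruct (fm_smooth_chi a F 2%nat tau s Ds) as (_ & _ & _ & (_ & _ & dW & _) & _).
  (* The target 0 is rewritten as half the [tau]-derivative of g(d_rho, d_rho). Commuting the mixed
     partials turns it into the pairing formula for the field d/dtau. *)
  rewrite <- (fermi_unit_speed_derive a ha F tau s Ds).
  rewrite <- (mixed_partials_comm _ _ _ _ (fm_dom_open a F) (fm_smooth_t a F) Ds).
  rewrite <- (mixed_partials_comm _ _ _ _ (fm_dom_open a F) (fm_smooth_chi a F) Ds).
  now apply (geodesic_pairing_is_derive a (fm_t F tau) (fm_chi F tau)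
    (fun r => Derive (fun u => fm_t F u r) tau) (fun r => Derive (fun u => fm_chi F u r) tau)).
Qed.

(** Test particles live at [chi > 0]. By the conserved pairing, [chi] increases strictly from 0
    along the geodesic. *)
Lemma fermi_chi_pos (a : R -> R) (ha : expanding a) (F : fermi_map a) (tau rho : R) :
  fm_dom F (tau, rho) -> 0 < rho -> 0 < fm_chi F tau rho.
Proof.
intros D pr. pose proof (fermi_dom_tau_pos a F tau rho D) as pt.
destruct (fermi_initial a F tau pt) as (_ & E2 & _ & _).
assert (I : forall s, Rmin 0 rho <= s <= Rmax 0 rho ->
  ex_derive (fm_chi F tau) s /\ 0 < Derive (fm_chi F tau) s).
{ intros s Hs. pose proof (fm_dom_radial a F tau rho s D Hs) as Ds.
  destruct (fermi_geodesic_at a ha F tau s Ds) as (pa & _ & _ & dX & _). split; trivial.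
  pose proof (fermi_angular_momentum a ha F tau s Ds) as E.
  pose proof (Defs.exp_pos a ha tau pt).
  apply Rmult_lt_reg_l with ((a (fm_t F tau s)) ^ 2); [now apply pow_lt | lra]. }
destruct (MVT_gen (fm_chi F tau) 0 rho (Derive (fm_chi F tau))) as (c & Hc & E).
- intros s Hs. apply Derive_correct, I. lra.
- intros s Hs. apply continuity_pt_filterlim, (ex_derive_continuous (fm_chi F tau) s), I, Hs.
- destruct (I c Hc). rewrite E2 in E. nra.
Qed.

(** * Four-velocities in Fermi coordinates and the speed bound *)

Lemma metric_fermi_frame (a : R -> R) (ha : expanding a) (C : fermi_chart a) (tau rho x y : R) :
  fm_dom C (tau, rho) ->
  let v := (Derive (fun u => fm_t C u rho) tau * x + Derive (fm_t C tau) rho * y,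
            Derive (fun u => fm_chi C u rho) tau * x + Derive (fm_chi C tau) rho * y) in
  metric a (fm_t C tau rho) v v = g_tautau C tau rho * x ^ 2 + y ^ 2.
Proof.
intros D v.
pose proof (gauss_lemma a ha C tau rho D) as H.
pose proof (fermi_unit_speed a ha C tau rho D) as U; simpl in U.
unfold g_tautau, d_tau, metric, v in *; cbn [fst snd] in *.
(* Here [g], [h], [u] are the frame components g(d_tau, d_tau), g(d_tau, d_rho), g(d_rho, d_rho);
   the Gauss lemma removes the cross term. *)
match type of H with ?h = 0 => match type of U with ?u = 1 =>
  match goal with |- _ = ?g * _ + _ =>
    transitivity (g * x ^ 2 + 2 * h * x * y + u * y ^ 2); [ring | rewrite H, U; ring]
  end end end.
Qed.

(** The Fermi map undoes the coordinate functions only in the region. Differentiating this identity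
    along a particle requires it to stay there for nearby proper times. *)
Lemma particle_near_region (a : R -> R) (C : fermi_chart a) (P : test_particle a) (s : R) :
  tp_dom P s -> fc_region C (tp_t P s, tp_chi P s) ->
  locally s (fun r => fc_region C (tp_t P r, tp_chi P r)).
Proof.
intros Ds Rs.
pose proof (tp_smooth_t a P 1%nat s Ds) as dt.
pose proof (tp_smooth_chi a P 1%nat s Ds) as dx.
destruct (fc_region_open a C _ Rs) as [e He].
assert (Lt : locally s (fun r => ball (tp_t P s) e (tp_t P r)))
  by exact (ex_derive_continuous _ _ dt _ (locally_ball (tp_t P s) e)).
assert (Lx : locally s (fun r => ball (tp_chi P s) e (tp_chi P r)))
  by exact (ex_derive_continuous _ _ dx _ (locally_ball (tp_chi P s) e)).
refine (filter_imp _ _ _ (filter_and _ _ Lt Lx)).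
intros r [H1 H2]. apply He. split; assumption.
Qed.

(** Near [s] the particle's path is the Fermi map applied to its own Fermi coordinates, so the chain
    rule decomposes the velocity in the frame d/dtau, d/drho without inverting a Jacobian. *)
Lemma particle_velocity (a : R -> R) (C : fermi_chart a) (P : test_particle a) (s tau rho : R) :
  fc_coords C (tau, rho) -> passes_through C P s tau rho ->
  Derive (tp_t P) s = Derive (fun u => fm_t C u rho) tau * tau_dot C P s
                      + Derive (fm_t C tau) rho * rho_dot C P s /\
  Derive (tp_chi P) s = Derive (fun u => fm_chi C u rho) tau * tau_dot C P s
                      + Derive (fm_chi C tau) rho * rho_dot C P s.
Proof.
intros K (Ds & Et & Ex).
destruct (fc_from a C tau rho K) as (Rg & Etau & Erho).
rewrite <- Et, <- Ex in Rg, Etau, Erho.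
assert (L := particle_near_region a C P s Ds Rg).
pose proof (tp_smooth_t a P 1%nat s Ds) as dt.
pose proof (tp_smooth_chi a P 1%nat s Ds) as dx.
assert (D1 : ex_derive (fun r => fc_tau C (tp_t P r) (tp_chi P r)) s).
{ eexists. now apply (is_derive_comp2 _ _ _ _ _ (fc_region_open a C) (fc_smooth_tau a C)). }
assert (D2 : ex_derive (fun r => fc_rho C (tp_t P r) (tp_chi P r)) s).
{ eexists. now apply (is_derive_comp2 _ _ _ _ _ (fc_region_open a C) (fc_smooth_rho a C)). }
assert (D : fm_dom C (fc_tau C (tp_t P s) (tp_chi P s), fc_rho C (tp_t P s) (tp_chi P s))).
{ rewrite Etau, Erho. now apply fc_coords_dom. }
pose proof (is_derive_comp2 _ _ (fun r => fc_tau C (tp_t P r) (tp_chi P r))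
  (fun r => fc_rho C (tp_t P r) (tp_chi P r)) s (fm_dom_open a C) (fm_smooth_t a C) D D1 D2) as H1.
pose proof (is_derive_comp2 _ _ (fun r => fc_tau C (tp_t P r) (tp_chi P r))
  (fun r => fc_rho C (tp_t P r) (tp_chi P r)) s (fm_dom_open a C) (fm_smooth_chi a C) D D1 D2) as H2.
cbv beta in H1, H2. rewrite Etau, Erho in H1, H2.
apply is_derive_unique in H1, H2. split.
- unfold tau_dot, rho_dot. rewrite <- H1. apply Derive_ext_loc.
  refine (filter_imp _ _ _ L). intros r Hr. symmetry. apply (fc_to a C _ _ Hr).
- unfold tau_dot, rho_dot. rewrite <- H2. apply Derive_ext_loc.
  refine (filter_imp _ _ _ L). intros r Hr. symmetry. apply (fc_to a C _ _ Hr).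
Qed.

Lemma particle_normalized (a : R -> R) (ha : expanding a) (C : fermi_chart a)
    (P : test_particle a) (s tau rho : R) :
  fc_coords C (tau, rho) -> passes_through C P s tau rho ->
  g_tautau C tau rho * tau_dot C P s ^ 2 + rho_dot C P s ^ 2 = -1.
Proof.
intros K Hp. destruct (particle_velocity a C P s tau rho K Hp) as [Vt Vx].
destruct Hp as (Ds & Et & Ex).
rewrite <- (metric_fermi_frame a ha C tau rho) by now apply fc_coords_dom.
rewrite <- Vt, <- Vx, <- Et. now apply tp_proper_time.
Qed.

Lemma fermi_speed_eq (a : R -> R) (ha : expanding a) (C : fermi_chart a)
    (P : test_particle a) (s tau rho : R) :
  fc_coords C (tau, rho) -> passes_through C P s tau rho ->
  fermi_speed C P s = Rabs (rho_dot C P s / tau_dot C P s).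
Proof.
intros K (Ds & Et & Ex).
destruct (fc_from a C tau rho K) as (_ & Etau & _). rewrite <- Et, <- Ex in Etau.
pose proof (Defs.exp_pos a ha tau (fermi_dom_tau_pos a C tau rho (fc_coords_dom a C _ K))) as pa.
unfold fermi_speed, spacelike_norm, v_fermi, radial_unit, metric; cbv zeta; cbn [fst snd].
rewrite Etau. set (k := rho_dot C P s / tau_dot C P s).
rewrite <- sqrt_Rsqr_abs. f_equal. unfold Rsqr. field. lra.
Qed.

Lemma fermi_speed_bound (a : R -> R) (ha : expanding a) (C : fermi_chart a)
    (P : test_particle a) (s tau rho : R) :
  fc_coords C (tau, rho) -> passes_through C P s tau rho ->
  fermi_speed C P s < sqrt (- g_tautau C tau rho).
Proof.
intros K Hp.
rewrite (fermi_speed_eq a ha C P s tau rho K Hp), <- sqrt_Rsqr_abs.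
pose proof (particle_normalized a ha C P s tau rho K Hp) as N.
set (x := tau_dot C P s) in *. set (y := rho_dot C P s) in *. set (g := g_tautau C tau rho) in *.
(* For [x = 0] the normalization would read y^2 = -1. *)
assert (x <> 0) by (intros E; rewrite E in N; nra).
assert (0 < x ^ 2) by nra.
apply sqrt_lt_1_alt. split; [apply Rle_0_sqr|].
replace ((y / x)²) with (y ^ 2 / x ^ 2) by (unfold Rsqr; field; assumption).
apply Rmult_lt_reg_r with (x ^ 2); trivial.
replace (y ^ 2 / x ^ 2 * x ^ 2) with (y ^ 2) by (field; assumption). lra.
Qed.

Lemma g_tautau_axis (a : R -> R) (C : fermi_chart a) (tau : R) :
  0 < tau -> g_tautau C tau 0 = -1.
Proof.
intros pt. destruct (fermi_d_tau_axis a C tau pt) as [E1 E2].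
unfold g_tautau, d_tau, metric; cbn [fst snd]. rewrite E1, E2. ring.
Qed.

(** * Smooth functions of one variable *)

(* Coquelicot has no Leibniz rule for [ex_derive_n].  This class is closed
   under differentiation, which makes the induction on the order trivial. *)
Inductive smooth_expr (I : R -> Prop) : (R -> R) -> Prop :=
| se_smooth f : smooth_on I f -> smooth_expr I f
| se_plus f g : smooth_expr I f -> smooth_expr I g -> smooth_expr I (fun s => f s + g s)
| se_mult f g : smooth_expr I f -> smooth_expr I g -> smooth_expr I (fun s => f s * g s)
| se_inv f : smooth_expr I f -> (forall s, I s -> f s <> 0) -> smooth_expr I (fun s => / f s).

Lemma smooth_on_Derive (I : R -> Prop) (f : R -> R) :
  smooth_on I f -> smooth_on I (Derive f).
Proof.
intros sf n s Is. destruct n as [|n]; [exact Logic.I|].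
apply (ex_derive_ext (Derive_n f (n + 1))).
- intros t. symmetry. apply (Derive_n_comp f n 1).
- replace (n + 1)%nat with (S n) by lia. apply (sf (S (S n)) s Is).
Qed.

Lemma smooth_on_const (I : R -> Prop) (c : R) : smooth_on I (fun _ => c).
Proof. intros n s _. apply ex_derive_n_const. Qed.

Lemma smooth_expr_derive (I : R -> Prop) (f : R -> R) : smooth_expr I f ->
  exists g, smooth_expr I g /\ forall s, I s -> is_derive f s (g s).
Proof.
induction 1 as [f sf | f g _ (f' & sf & df) _ (g' & sg & dg)
  | f g sf0 (f' & sf & df) sg0 (g' & sg & dg) | f sf0 (f' & sf & df) nz].
- exists (Derive f). split.
  + now apply se_smooth, smooth_on_Derive.
  + intros s Is. apply Derive_correct, (sf 1%nat s Is).
- exists (fun s => f' s + g' s). split; [now apply se_plus|].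
  intros s Is. now apply (is_derive_plus f g); [apply df | apply dg].
- exists (fun s => f' s * g s + f s * g' s). split.
  + now apply se_plus; apply se_mult.
  + intros s Is. apply (is_derive_mult f g); [now apply df | now apply dg | intros; apply Rmult_comm].
(* This is -f'/f^2, written with the constructors of the class only. *)
- exists (fun s => (-1) * (f' s * (/ f s * / f s))). split.
  + apply se_mult; [apply se_smooth, smooth_on_const|].
    apply se_mult; trivial. now apply se_mult; apply se_inv.
  + intros s Is. evar_last.
    * apply is_derive_inv; [apply df | apply nz]; assumption.
    * simpl. field. now apply nz.
Qed.

(** By induction every iterated derivative agrees on [I] with a member of the class. The agreement
    holds only on [I], and openness makes it local, so that it can be differentiated again. *)
Lemma smooth_of_smooth_expr (I : R -> Prop) (f : R -> R) :
  open I -> smooth_expr I f -> smooth_on I f.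
Proof.
intros oI sf.
assert (H : forall n, exists g, smooth_expr I g /\ forall s, I s -> Derive_n f n s = g s).
{ induction n as [|n (g & sg & E)].
  - now exists f.
  - destruct (smooth_expr_derive I g sg) as (g' & sg' & dg). exists g'. split; trivial.
    intros s Is. simpl. rewrite (Derive_ext_loc _ g).
    + now apply is_derive_unique, dg.
    + exact (filter_imp _ _ E (oI s Is)). }
intros [|n] s Is; [exact Logic.I|].
destruct (H n) as (g & sg & E). destruct (smooth_expr_derive I g sg) as (g' & sg' & dg).
apply (ex_derive_ext_loc g).
- refine (filter_imp _ _ _ (oI s Is)). intros t It. symmetry. now apply E.
- eexists. now apply dg.
Qed.

Lemma smooth_antiderivative (I : R -> Prop) (f g : R -> R) :
  open I -> smooth_on I g -> (forall s, I s -> is_derive f s (g s)) -> smooth_on I f.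
Proof.
intros oI sg df [|n] s Is; [exact Logic.I|].
destruct n as [|n].
- eexists. now apply df.
- apply (ex_derive_ext_loc (Derive_n g n)); [|exact (sg (S n) s Is)].
  refine (filter_imp _ _ _ (oI s Is)). intros t It.
  (* Near [t] the derivative of [f] is [g], so order [n + 1] for [f] is order [n] for [g]. *)
  replace (S n) with (n + 1)%nat by lia. rewrite <- Derive_n_comp.
  apply Derive_n_ext_loc. refine (filter_imp _ _ _ (oI t It)). intros r Ir.
  symmetry. now apply is_derive_unique, df.
Qed.

Lemma smooth_comp_affine (I : R -> Prop) (f : R -> R) (c d : R) :
  open I -> smooth_on I f -> smooth_on (fun s => I (c * s + d)) (fun s => f (c * s + d)).
Proof.
intros oI sf n s Is.
apply (ex_derive_n_comp_scal (fun y => f (y + d))).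
assert (L : locally (c * s) (fun y => I (y + d))).
{ apply (open_comp (fun y => y + d) I); trivial.
  intros y _. apply (continuous_plus (fun y => y) (fun _ => d)).
  - apply continuous_id.
  - apply continuous_const. }
refine (filter_imp _ _ _ L). intros y Iy k _.
now apply ex_derive_n_comp_trans, sf.
Qed.

(** Since [I] is an interval, the segment from [x0] to any [r] near [s] stays in [I], where [f] is
    continuous and hence integrable. *)
Lemma is_derive_RInt_interval (I : R -> Prop) (f : R -> R) (x0 s : R) :
  Defs.open_interval I -> (forall r, I r -> continuous f r) -> I x0 -> I s ->
  is_derive (fun r => RInt f x0 r) s (f s).
Proof.
intros [oI cI] cf I0 Is. apply (is_derive_RInt f (fun r => RInt f x0 r) x0 s); [|now apply cf].
refine (filter_imp _ _ _ (oI s Is)). intros r Ir.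
apply (RInt_correct f), (ex_RInt_continuous f). intros z Hz.
apply cf. destruct (Rle_or_lt x0 r) as [H|H].
- rewrite Rmin_left, Rmax_right in Hz by lra. now apply (cI x0 z r).
- rewrite Rmin_right, Rmax_left in Hz by lra. now apply (cI r z x0).
Qed.

(** * Construction of a superluminal particle *)

(* A particle of constant velocity with respect to the comoving observers, so
   that [t] is affine in proper time and [chi] is an antiderivative. *)
Lemma particle_with_velocity (a : R -> R) (ha : expanding a) (t0 x0 c b : R) :
  0 < t0 -> 0 < x0 -> 0 < c -> - c ^ 2 + b ^ 2 = -1 ->
  exists P : test_particle a, tp_dom P 0 /\ tp_t P 0 = t0 /\ tp_chi P 0 = x0 /\
    Derive (tp_t P) 0 = c /\ Derive (tp_chi P) 0 = b / a t0.
Proof.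
intros pt px pc N.
set (J := fun s : R => 0 < c * s + t0).
(* This will be dchi/ds: the orthonormal component a dchi/ds is then the constant [b], and the
   normalization is the hypothesis on [c] and [b] at every [s]. *)
set (f := fun s : R => b * / a (c * s + t0)).
set (X := fun s : R => x0 + RInt f 0 s).
assert (oJ : open J).
{ apply (open_comp (fun s => c * s + t0) (fun t => 0 < t)); [|apply open_gt].
  intros s _. apply (ex_derive_continuous (fun s => c * s + t0)). auto_derive. exact Logic.I. }
assert (iJ : Defs.open_interval J).
{ split; trivial. unfold J. intros x y z Jx Jz Hy. nra. }
assert (J0 : J 0) by (unfold J; lra).
assert (sf : smooth_on J f).
{ apply smooth_of_smooth_expr; trivial. apply se_mult; [apply se_smooth, smooth_on_const|].
  apply se_inv.
  - apply se_smooth. apply (smooth_comp_affine (fun t => 0 < t) a); [apply open_gt | apply ha].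
  - intros s Js. pose proof (Defs.exp_pos a ha _ Js). lra. }
assert (dX : forall s, J s -> is_derive X s (f s)).
{ intros s Js. unfold X. evar_last.
  - apply (is_derive_plus (fun _ => x0) (fun r => RInt f 0 r)).
    + apply is_derive_const.
    + apply (is_derive_RInt_interval J); trivial.
      intros r Jr. apply (ex_derive_continuous f r), (sf 1%nat r Jr).
  - apply plus_zero_l. }
assert (X0 : X 0 = x0) by (unfold X; rewrite RInt_point; apply Rplus_0_r).
assert (L : locally 0 (fun s => J s /\ 0 < X s)).
{ apply filter_and; [now apply oJ|].
  apply (ex_derive_continuous X 0).
  - eexists. now apply dX.
  - apply open_gt. rewrite X0. exact px. }
destruct L as [e He].
(* The lifetime is cut down to a symmetric interval on which both [t] and [chi] stay positive. *)
set (I := fun s : R => - e < s /\ s < e).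
assert (IJ : forall s, I s -> J s /\ 0 < X s).
{ intros s [H1 H2]. apply He. change (Rabs (s - 0) < e). apply Rabs_def1; lra. }
assert (oI : open I) by (apply open_and; [apply open_gt | apply open_lt]).
assert (dt : forall s, is_derive (fun s => c * s + t0) s c).
{ intros s. auto_derive; [exact Logic.I | ring]. }
assert (Dt : forall s, Derive (fun s => c * s + t0) s = c) by (intros s; apply is_derive_unique, dt).
assert (I0 : I 0) by (pose proof (cond_pos e); unfold I; lra).
unshelve eexists (Build_test_particle a I (fun s => c * s + t0) X _ _ _ _ _ _ _).
- split; trivial. unfold I. intros x y z. lra.
- apply (smooth_antiderivative _ _ (fun _ => c)); trivial. apply smooth_on_const.
- apply (smooth_antiderivative _ _ f); trivial.
  + intros n s Is. now apply sf, IJ.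
  + intros s Is. now apply dX, IJ.
- intros s Is. now apply IJ.
- intros s Is. now apply IJ.
- intros s Is. now rewrite Dt.
- intros s Is. destruct (IJ s Is) as [Js _].
  rewrite Dt, (is_derive_unique _ _ _ (dX s Js)).
  pose proof (Defs.exp_pos a ha _ Js). unfold metric, f; cbn [fst snd].
  rewrite <- N. field. lra.
- cbn [tp_dom tp_t tp_chi]. split; [exact I0|]. split; [ring|]. split; [exact X0|].
  split; [apply Dt|]. rewrite (is_derive_unique _ _ _ (dX 0 J0)). unfold f.
  now replace (c * 0 + t0) with t0 by ring.
Qed.

(** The frame is orthogonal with nonzero squared lengths [g_tautau] and 1, so pairing the difference
    of the two vectors with d/dtau and d/drho isolates [x - x'] and [y - y']. *)
Lemma fermi_frame_injective (a : R -> R) (ha : expanding a) (C : fermi_chart a)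
    (tau rho x y x' y' : R) :
  fm_dom C (tau, rho) -> g_tautau C tau rho <> 0 ->
  Derive (fun u => fm_t C u rho) tau * x + Derive (fm_t C tau) rho * y =
  Derive (fun u => fm_t C u rho) tau * x' + Derive (fm_t C tau) rho * y' ->
  Derive (fun u => fm_chi C u rho) tau * x + Derive (fm_chi C tau) rho * y =
  Derive (fun u => fm_chi C u rho) tau * x' + Derive (fm_chi C tau) rho * y' ->
  x = x' /\ y = y'.
Proof.
intros D ng Et Ex.
pose proof (gauss_lemma a ha C tau rho D) as H.
pose proof (fermi_unit_speed a ha C tau rho D) as U; simpl in U.
unfold g_tautau, d_tau, metric in *; cbn [fst snd] in *.
set (p := Derive (fun u => fm_t C u rho) tau) in *. set (q := Derive (fm_t C tau) rho) in *.
set (r := Derive (fun u => fm_chi C u rho) tau) in *. set (t := Derive (fm_chi C tau) rho) in *.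
set (A := a (fm_t C tau rho)) in *.
assert (E1 : p * (x - x') + q * (y - y') = 0) by lra.
assert (E2 : r * (x - x') + t * (y - y') = 0) by lra.
split; apply Rminus_diag_uniq.
- apply Rmult_eq_reg_l with (- (p * p) + A ^ 2 * (r * r)); trivial.
  transitivity (- p * (p * (x - x') + q * (y - y')) + A ^ 2 * r * (r * (x - x') + t * (y - y'))
    - (y - y') * (- (p * q) + A ^ 2 * (r * t))); [ring|].
  rewrite E1, E2, H. ring.
- transitivity ((y - y') * (- (q * q) + A ^ 2 * (t * t))); [rewrite U; ring|].
  transitivity (- q * (p * (x - x') + q * (y - y')) + A ^ 2 * t * (r * (x - x') + t * (y - y'))
    - (x - x') * (- (p * q) + A ^ 2 * (r * t))); [ring|].
  rewrite E1, E2, H. ring.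
Qed.

Lemma fermi_speed_superluminal (a : R -> R) (ha : expanding a) (C : fermi_chart a) (tau rho : R) :
  fc_coords C (tau, rho) -> 0 <= rho -> 1 < - g_tautau C tau rho ->
  exists (P : test_particle a) (s : R), passes_through C P s tau rho /\ 1 < fermi_speed C P s.
Proof.
intros K pr HG. pose proof (fc_coords_dom a C _ K) as D.
(* The axis is excluded because [g_tautau = -1] there. *)
assert (pr' : 0 < rho).
{ destruct pr as [pr|pr]; trivial. exfalso. subst rho.
  rewrite (g_tautau_axis a C tau (fermi_dom_tau_pos a C tau 0 D)) in HG. lra. }
pose proof (fermi_chi_pos a ha C tau rho D pr') as px.
assert (pt : 0 < fm_t C tau rho) by apply (fc_region_pos a C _ _ (proj1 (fc_from a C tau rho K))).
pose proof (Defs.exp_pos a ha _ pt) as pa.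
set (G := - g_tautau C tau rho) in *.
assert (exists x y, 0 < x < y /\ G * x ^ 2 = 1 + y ^ 2) as (x & y & Hxy & N0).
(* The solution with [(y / x)^2 = (G + 1) / 2], the midpoint of 1 and G. *)
{ exists (sqrt (2 / (G - 1))), (sqrt ((G + 1) / (G - 1))).
  assert (0 < 2 / (G - 1)) by (apply Rdiv_lt_0_compat; lra).
  assert (2 / (G - 1) < (G + 1) / (G - 1)).
  { apply Rmult_lt_compat_r; [apply Rinv_0_lt_compat|]; lra. }
  repeat split.
  - now apply sqrt_lt_R0.
  - apply sqrt_lt_1_alt. lra.
  - rewrite !pow2_sqrt by lra. field. lra. }
(* Reversing both signs keeps the ratio and the normalization, so the vector can be made
   future-directed. *)
assert (exists x y, x <> 0 /\ Rabs x < Rabs y /\ G * x ^ 2 = 1 + y ^ 2 /\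
  0 < Derive (fun u => fm_t C u rho) tau * x + Derive (fm_t C tau) rho * y)
  as (x' & y' & nx & lxy & N & pv).
{ pose proof (metric_fermi_frame a ha C tau rho x y D) as M.
  unfold metric in M; cbn [fst snd] in M.
  set (v := Derive (fun u => fm_t C u rho) tau * x + Derive (fm_t C tau) rho * y) in *.
  (* A vector without d/dt component has nonnegative squared length, whereas this one has -1. *)
  assert (nv : v <> 0).
  { intros E. rewrite E in M. fold G in M.
    match type of M with - (0 * 0) + ?A ^ 2 * (?w * ?w) = _ => pose proof (Rle_0_sqr (A * w)) end.
    unfold G, Rsqr in *. nra. }
  destruct (Rlt_or_le 0 v) as [H|H].
  - exists x, y. repeat split; trivial; [lra|]. rewrite !Rabs_pos_eq; lra.
  - exists (- x), (- y). repeat split; [lra | | |].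
    + rewrite !Rabs_Ropp, !Rabs_pos_eq; lra.
    + nra.
    + unfold v in *. lra. }
clear x y Hxy N0.
set (v := Derive (fun u => fm_t C u rho) tau * x' + Derive (fm_t C tau) rho * y') in *.
set (w := Derive (fun u => fm_chi C u rho) tau * x' + Derive (fm_chi C tau) rho * y').
(* The prescribed 4-velocity is [(v, w)]; its orthonormal spatial component is [a * w]. *)
destruct (particle_with_velocity a ha (fm_t C tau rho) (fm_chi C tau rho) v
  (a (fm_t C tau rho) * w) pt px pv) as (P & D0 & Et & Ex & Vt & Vx).
{ pose proof (metric_fermi_frame a ha C tau rho x' y' D) as M.
  unfold metric in M; cbn [fst snd] in M. fold v w in M. unfold G in N. nra. }
assert (Hp : passes_through C P 0 tau rho) by now repeat split.
exists P, 0. split; trivial.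
rewrite (fermi_speed_eq a ha C P 0 tau rho K Hp).
destruct (particle_velocity a C P 0 tau rho K Hp) as [Ft Fx].
replace (a (fm_t C tau rho) * w / a (fm_t C tau rho)) with w in Vx by (field; lra).
rewrite Vt in Ft. rewrite Vx in Fx. unfold v in Ft. unfold w in Fx.
(* The 4-velocity was prescribed in coordinates [t], [chi]; injectivity of the frame identifies
   [tau_dot] and [rho_dot] with the chosen [x'] and [y']. *)
destruct (fermi_frame_injective a ha C tau rho x' y' (tau_dot C P 0) (rho_dot C P 0)) as [<- <-]; trivial.
{ unfold G in HG. lra. }
rewrite Rabs_div by trivial. apply Rmult_lt_reg_r with (Rabs x'); [now apply Rabs_pos_lt|].
replace (Rabs y' / Rabs x' * Rabs x') with (Rabs y') by (field; now apply Rabs_no_R0). lra.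
Qed.

Theorem proposition2p1 (a : R -> R) (ha : expanding a) (C : fermi_chart a) :
  (forall (tau rho : R) (P : test_particle a) (s : R),
     fc_coords C (tau, rho) -> passes_through C P s tau rho ->
     fermi_speed C P s < sqrt (- g_tautau C tau rho))
  /\
  (forall tau rho : R,
     fc_coords C (tau, rho) -> 0 <= rho ->
     ((exists (P : test_particle a) (s : R),
         passes_through C P s tau rho /\ 1 < fermi_speed C P s)
      <-> 1 < - g_tautau C tau rho)).
Proof.
split.
- intros tau rho P s. now apply fermi_speed_bound.
- intros tau rho K pr. split.
  + intros (P & s & Hp & H). pose proof (fermi_speed_bound a ha C P s tau rho K Hp) as B.
    apply sqrt_lt_0_alt. rewrite sqrt_1. lra.
  + now apply fermi_speed_superluminal.
Qed.
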